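(* Consider the complex 3-dimensional Novikov algebras $C_1$, $C_2$, $C_3$, $C_4$, $C_5(\alpha)$ $(\alpha\in\mathbb{C})$, $C_6(\beta)$ $(\beta\in\mathbb{C})$, $C_7(\gamma)$ $(\gamma\in\mathbb{C}\setminus\{0\})$ and $A_1,\dots,A_{12}$ given by the products listed in the context. For $A$ in the first list (type $C$) and $1\le j\le12$, the algebra $A_j$ lies in $\partial O(A)$ if and only if $A_j$ is one of the algebras given for $A$ below: \begin{itemize} \item $A=C_1$: $A_1, A_2, A_5, A_6, A_9, A_{10}$; \item $A=C_2$: $A_1, A_5$; \item $A=C_3$: $A_1, A_5$; \item $A=C_4$: $A_1, A_5$; \item $A=C_5(\alpha)$, $\alpha\in\mathbb{C}$: $A_1, A_5$; \item $A=C_6(\beta)$ with $\beta\neq-1$: $A_1, A_2, A_5, A_6, A_9, A_{10}$; \item $A=C_6(-1)$: $A_1, A_2, A_5$; \item $A=C_7(\gamma)$ with $\gamma\neq0$: $A_1, A_5$. \end{itemize}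
   Context: A Novikov algebra over $\mathbb{C}$ is a complex vector space with a bilinear product satisfying $(x\cdot y)\cdot z-x\cdot(y\cdot z)=(y\cdot x)\cdot z-y\cdot(x\cdot z)$ and $(x\cdot y)\cdot z=(x\cdot z)\cdot y$ for all $x,y,z$. Fix a 3-dimensional complex vector space $V$ with basis $(e_1,e_2,e_3)$. The set of Novikov products on $V$, identified with their structure constants in $\mathbb{C}^{27}$, is an affine algebraic set, on which $GL_3(\mathbb{C})$ acts by $(g\circ\mu)(x,y)=g(\mu(g^{-1}x,g^{-1}y))$. For a 3-dimensional Novikov algebra $A$, $O(A)$ is the orbit of a structure representing $A$, $\overline{O(A)}$ its Zariski closure, and $\partial O(A)=\overline{O(A)}\setminus O(A)$; ''$B$ lies in $\partial O(A)$'' means that a structure representing $B$ lies in $\partial O(A)$. The algebras (basis $e_1,e_2,e_3$; products of basis vectors not listed are zero): $C_1$: $e_1e_1=-e_1+e_2$, $e_2e_1=-e_2$, $e_3e_3=e_3$. $C_2$: $e_1e_1=-e_1+e_2$, $e_1e_3=-e_3$, $e_2e_1=-e_2$, $e_3e_1=-e_3$. $C_3$: $e_1e_1=-e_1+e_2$, $e_2e_1=-e_2$. $C_4$: $e_1e_1=e_3$, $e_1e_2=e_2$. $C_5(\alpha)$: $e_1e_1=\alpha e_1$, $e_1e_2=(\alpha+1)e_2$, $e_2e_1=\alpha e_2$. $C_6(\beta)$: $e_1e_1=\beta e_1$, $e_1e_2=(\beta+1)e_2$, $e_2e_1=\beta e_2$, $e_3e_3=e_3$. $C_7(\gamma)$,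 $\gamma\ne0$: $e_1e_1=\gamma e_1$, $e_1e_2=(\gamma+1)e_2$, $e_1e_3=\gamma e_3$, $e_2e_1=\gamma e_2$, $e_3e_1=\gamma e_3$. $A_1$: all products zero. $A_2$: $e_3e_3=e_3$. $A_3$: $e_2e_2=e_2$, $e_3e_3=e_3$. $A_4$: $e_1e_1=e_1$, $e_2e_2=e_2$, $e_3e_3=e_3$. $A_5$: $e_2e_2=e_1$. $A_6$: $e_2e_2=e_1$, $e_3e_3=e_3$. $A_7$: $e_1e_2=e_1$, $e_2e_1=e_1$, $e_2e_2=e_2$. $A_8$: $e_1e_2=e_1$, $e_2e_1=e_1$, $e_2e_2=e_2$, $e_3e_3=e_3$. $A_9$: $e_2e_3=e_1$, $e_3e_2=e_1$. $A_{10}$: $e_2e_3=e_1$, $e_3e_2=e_1$, $e_3e_3=e_2$. $A_{11}$: $e_1e_3=e_1$, $e_2e_3=e_2$, $e_3e_1=e_1$, $e_3e_2=e_2$, $e_3e_3=e_3$. $A_{12}$: $e_1e_3=e_1$, $e_2e_2=e_1$, $e_2e_3=e_2$, $e_3e_1=e_1$, $e_3e_2=e_2$, $e_3e_3=e_3$. *)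

(* Defs.v *)
From HB Require Import structures.
From mathcomp Require Import all_boot all_order all_algebra.
From mathcomp Require Import classical_sets reals complex mpoly.
Set Implicit Arguments.
Unset Strict Implicit.
Unset Printing Implicit Defensive.
Import GRing.Theory.
Local Open Scope classical_set_scope.
Local Open Scope ring_scope.

Section Structures.
Variable R : realType.
Notation C := R[i].
Notation V := 'cV[C]_3.

(* A point of C^27: mu (i, j, k) is the coefficient of e_k in e_i e_j. *)
Definition structure : Type := {ffun 'I_3 * 'I_3 * 'I_3 -> C}.

(* Basis vectors are numbered from 1: [e 1], [e 2], [e 3]. *)
Definition e (n : nat) : V := \col_(i < 3) (i.+1 == n)%:R.

Definition mul (mu : structure) (x y : V) : V :=
  \col_(k < 3) \sum_(i < 3) \sum_(j < 3) x i 0 * y j 0 * mu (i, j, k).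

Definition structure_of (f : V -> V -> V) : structure :=
  [ffun t : 'I_3 * 'I_3 * 'I_3 => f (e t.1.1.+1) (e t.1.2.+1) t.2 0].

Definition Novikov (mu : structure) : Prop :=
  (forall x y z : V,
     mul mu (mul mu x y) z - mul mu x (mul mu y z) =
     mul mu (mul mu y x) z - mul mu y (mul mu x z)) /\
  (forall x y z : V, mul mu (mul mu x y) z = mul mu (mul mu x z) y).

Definition act (g : 'M[C]_3) (mu : structure) : structure :=
  structure_of (fun x y => g *m mul mu (invmx g *m x) (invmx g *m y)).

Definition orbit (mu : structure) : set structure :=
  [set nu | exists2 g : 'M[C]_3, g \in unitmx & nu = act g mu].

(* The 27 variables are indexed by the enumeration of 'I_3 * 'I_3 * 'I_3. *)
Definition poly_eval (p : {mpoly C[#|{: 'I_3 * 'I_3 * 'I_3}|]})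
    (mu : structure) : C :=
  p.@[fun i => mu (enum_val i)].

(* Closure for the topology induced on the variety of Novikov structures;
   that variety being Zariski closed in C^27, for S inside it this is also the
   closure of S in C^27. *)
Definition zariski_closure (S : set structure) : set structure :=
  [set nu | Novikov nu /\
    forall p, (forall mu, S mu -> poly_eval p mu = 0) -> poly_eval p nu = 0].

Definition boundary (mu : structure) : set structure :=
  zariski_closure (orbit mu) `\` orbit mu.

Definition lies_in_boundary (B A : structure) : Prop :=
  exists2 nu, orbit B nu & boundary A nu.

(* Structure with e_i e_j = T i j, where i and j are numbered from 1. *)
Definition table (T : nat -> nat -> V) : structure :=
  [ffun t : 'I_3 * 'I_3 * 'I_3 => T t.1.1.+1 t.1.2.+1 t.2 0].

Local Open Scope nat_scope.

Definition C1 : structure := table (fun i j => match i, j with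
  | 1, 1 => (- e 1 + e 2)%R
  | 2, 1 => (- e 2)%R
  | 3, 3 => e 3
  | _, _ => 0%R
  end).

Definition C2 : structure := table (fun i j => match i, j with
  | 1, 1 => (- e 1 + e 2)%R
  | 1, 3 => (- e 3)%R
  | 2, 1 => (- e 2)%R
  | 3, 1 => (- e 3)%R
  | _, _ => 0%R
  end).

Definition C3 : structure := table (fun i j => match i, j with
  | 1, 1 => (- e 1 + e 2)%R
  | 2, 1 => (- e 2)%R
  | _, _ => 0%R
  end).

Definition C4 : structure := table (fun i j => match i, j with
  | 1, 1 => e 3
  | 1, 2 => e 2
  | _, _ => 0%R
  end).

Definition C5 (a : C) : structure := table (fun i j => match i, j with
  | 1, 1 => (a *: e 1)%R
  | 1, 2 => ((a + 1) *: e 2)%R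
  | 2, 1 => (a *: e 2)%R
  | _, _ => 0%R
  end).

Definition C6 (b : C) : structure := table (fun i j => match i, j with
  | 1, 1 => (b *: e 1)%R
  | 1, 2 => ((b + 1) *: e 2)%R
  | 2, 1 => (b *: e 2)%R
  | 3, 3 => e 3
  | _, _ => 0%R
  end).

Definition C7 (c : C) : structure := table (fun i j => match i, j with
  | 1, 1 => (c *: e 1)%R
  | 1, 2 => ((c + 1) *: e 2)%R
  | 1, 3 => (c *: e 3)%R
  | 2, 1 => (c *: e 2)%R
  | 3, 1 => (c *: e 3)%R
  | _, _ => 0%R
  end).

(* Junk (the zero structure) unless 1 <= n <= 12. *)
Definition A (n : nat) : structure := table (fun i j => match n, i, j with
  | 2, 3, 3 => e 3

  | 3, 2, 2 => e 2
  | 3, 3, 3 => e 3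

  | 4, 1, 1 => e 1
  | 4, 2, 2 => e 2
  | 4, 3, 3 => e 3

  | 5, 2, 2 => e 1

  | 6, 2, 2 => e 1
  | 6, 3, 3 => e 3

  | 7, 1, 2 => e 1
  | 7, 2, 1 => e 1
  | 7, 2, 2 => e 2

  | 8, 1, 2 => e 1
  | 8, 2, 1 => e 1
  | 8, 2, 2 => e 2
  | 8, 3, 3 => e 3

  | 9, 2, 3 => e 1
  | 9, 3, 2 => e 1

  | 10, 2, 3 => e 1
  | 10, 3, 2 => e 1
  | 10, 3, 3 => e 2

  | 11, 1, 3 => e 1
  | 11, 2, 3 => e 2
  | 11, 3, 1 => e 1
  | 11, 3, 2 => e 2
  | 11, 3, 3 => e 3

  | 12, 1, 3 => e 1
  | 12, 2, 2 => e 1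
  | 12, 2, 3 => e 2
  | 12, 3, 1 => e 1
  | 12, 3, 2 => e 2
  | 12, 3, 3 => e 3

  | _, _, _ => 0%R
  end).

End Structures.

(* Main.v *)
Require Import Defs.
From HB Require Import structures.
From mathcomp Require Import all_boot all_order all_algebra.
From mathcomp Require Import classical_sets reals complex mpoly.
From mathcomp Require Import ring.
Import Defs.
Local Open Scope ring_scope.
Set Implicit Arguments.
Unset Strict Implicit.
Unset Printing Implicit Defensive.
Import GRing.Theory Num.Theory.

(** Every [A n] is commutative and associative while none of the algebras [C1],
    ..., [C7 c] is commutative, so [A n] is never in their orbits and the
    boundary question is only whether [A n] is in the orbit closure.

    Degenerations are produced from weights. If a basis of an algebra has
    weights such that [e_i e_j] only involves [e_k] with
    [w k <= w i + w j], rescaling [e_i] by [t ^ w i] and letting [t] tend to [0]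
    yields the associated graded product ([degenerates_graded]). With a suitable
    basis this gives [A 5] as soon as some [v] is linearly independent from
    [v v], gives [A 2] when an idempotent annihilates a complementary plane, and
    [A 6] when that plane also contains such a pair [v], [v v]. Since degeneration is
    transitive, [A 6 -> A 10 -> A 9] and [A 6 -> A 5] supply the remaining ones.

    Non-degenerations come from conditions that are polynomial in the structure
    constants and independent of the basis, hence pass from an algebra to its
    orbit closure. They are built from the traces of the left and right
    multiplications by [x]. The difference [f] of these linear forms is the first
    coordinate on each of the algebras [C1], ..., [C7 c], but it vanishes on any
    commutative algebra. Two kinds of conditions are used.

    - Some [trR - s f] is zero on [C2], [C3], [C4], [C5 a], [C7 c], and it is an
      algebra morphism to the ground field, namely the third coordinate, on [C1]
      and [C6 b]. On a commutative limit this form is the trace of multiplication.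
      That trace vanishes only on [A 1], [A 5], [A 9], [A 10], and it is
      multiplicative only on these and [A 2], [A 6]: an idempotent of trace at
      least [2] contradicts multiplicativity.

    - Correcting a combination of [x y] and [y x] with total coefficient [1] by
      multiples of [f(y) x] and [f(x) y] produces a product of the form
      [phi(y) W(x)] on [C2], [C3], [C4], [C5 a], [C7 c], and also on
      [C6 (-1)]. On a commutative limit the corrections disappear and the
      limit product itself satisfies the quadratic relations of such a
      decomposable product. The algebras [A 6], [A 9], [A 10] violate them. *)

Section NovikovDegenerations.
Variable R : realType.
Notation C := R[i].
Notation V := 'cV[C]_3.
Notation structure := (structure R).
Notation e := (e R).
Notation A := (A R).
Implicit Types (mu nu : structure) (x y z u v w : V) (P Q : 'M[C]_3).

Local Notation i1 := (@Ordinal 3 0 isT).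
Local Notation i2 := (@Ordinal 3 1 isT).
Local Notation i3 := (@Ordinal 3 2 isT).

(** * Structures, orbits and multiplication operators *)

Lemma sum3 (F : 'I_3 -> C) : \sum_i F i = F i1 + F i2 + F i3.
Proof.
rewrite !big_ord_recl big_ord0 addr0 addrA.
by congr (F _ + F _ + F _); apply: val_inj.
Qed.

Lemma forall3 (Q : 'I_3 -> Prop) : Q i1 -> Q i2 -> Q i3 -> forall i, Q i.
Proof.
move=> q1 q2 q3 [[|[|[|//]]] h].
- by rewrite (_ : Ordinal h = i1) //; apply: val_inj.
- by rewrite (_ : Ordinal h = i2) //; apply: val_inj.
- by rewrite (_ : Ordinal h = i3) //; apply: val_inj.
Qed.

Lemma vec_ext x y : (forall k, x k 0 = y k 0) -> x = y.
Proof. by move=> h; apply/matrixP => k l; rewrite ord1. Qed.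

Lemma e_delta (i : 'I_3) : e i.+1 = delta_mx i 0.
Proof.
by apply: vec_ext => k; rewrite !mxE eqSS andbT.
Qed.

Lemma mx_ext_basis P Q : (forall i : 'I_3, P *m e i.+1 = Q *m e i.+1) -> P = Q.
Proof.
move=> h; apply/matrixP => k i; move/(congr1 (fun x : V => x k 0)): (h i).
by rewrite e_delta -!colE !mxE.
Qed.

Lemma mx_ext P Q : (forall x, P *m x = Q *m x) -> P = Q.
Proof. by move=> h; apply: mx_ext_basis => i; apply: h. Qed.

Definition Lmul mu x : 'M[C]_3 := \matrix_(k, j) \sum_i x i 0 * mu (i, j, k).
Definition Rmul mu y : 'M[C]_3 := \matrix_(k, i) \sum_j y j 0 * mu (i, j, k).

Lemma LmulE mu x y : mul mu x y = Lmul mu x *m y.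
Proof.
apply: vec_ext => k; rewrite !mxE exchange_big /=; apply: eq_bigr => j _.
by rewrite mxE mulr_suml; apply: eq_bigr => i _; rewrite -!mulrA [_ * y j 0]mulrC.
Qed.

Lemma RmulE mu x y : mul mu x y = Rmul mu y *m x.
Proof.
apply: vec_ext => k; rewrite !mxE; apply: eq_bigr => i _.
by rewrite mxE mulr_suml; apply: eq_bigr => j _; rewrite [RHS]mulrC !mulrA.
Qed.

Lemma mul_e_e mu (i j k : 'I_3) : mul mu (e i.+1) (e j.+1) k 0 = mu (i, j, k).
Proof.
rewrite LmulE (e_delta j) -colE !mxE (bigD1 i) //= e_delta mxE !eqxx mul1r.
by rewrite big1 ?addr0 // => l /negPf li; rewrite mxE li mul0r.
Qed.

Lemma structure_ext mu nu : (forall x y, mul mu x y = mul nu x y) -> mu = nu.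
Proof. by move=> h; apply/ffunP => -[[i j] k]; rewrite -!mul_e_e h. Qed.

(** [act] is defined through values on basis vectors; the formula holds on all
    vectors because the transported product is bilinear, which is expressed by
    writing it as a matrix acting on either argument. *)
Lemma mul_act P mu x y :
  mul (act P mu) x y = P *m mul mu (invmx P *m x) (invmx P *m y).
Proof.
set f := fun x y : V => P *m mul mu (invmx P *m x) (invmx P *m y).
have fL u v : f u v = P *m Lmul mu (invmx P *m u) *m invmx P *m v.
  by rewrite /f LmulE !mulmxA.
have fR u v : f u v = P *m Rmul mu (invmx P *m v) *m invmx P *m u.
  by rewrite /f RmulE !mulmxA.
rewrite -/(f x y); apply: vec_ext => k.
rewrite fR [RHS]mxE mxE; apply: eq_bigr => i _.
have -> : (P *m Rmul mu (invmx P *m y) *m invmx P) k i = f (e i.+1) y k 0.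
  by rewrite fR e_delta -colE [RHS]mxE.
rewrite fL [X in _ = X * _]mxE mulr_suml; apply: eq_bigr => j _.
have -> : (P *m Lmul mu (invmx P *m e i.+1) *m invmx P) k j
          = f (e i.+1) (e j.+1) k 0.
  by rewrite fL (e_delta j) -colE [RHS]mxE.
by rewrite ffunE /= -/(f _ _) mulrC -!mulrA [x i 0 * _]mulrC mulrA.
Qed.

Definition intertwines P mu nu :=
  forall x y, mul mu (P *m x) (P *m y) = P *m mul nu x y.

(** The columns of [P] form a basis in which the structure constants of [mu] are
    those of [nu]. This form avoids the inverse matrices of [act]. *)
Lemma orbitP mu nu : orbit mu nu <-> exists2 P, P \in unitmx & intertwines P mu nu.
Proof.
split=> [[g ug ->]|[P uP h]].
  exists (invmx g); first by rewrite unitmx_inv.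
  by move=> x y; rewrite mul_act mulKmx.
exists (invmx P); first by rewrite unitmx_inv.
by apply: structure_ext => x y; rewrite mul_act invmxK h mulKmx.
Qed.

Lemma orbit_sym mu nu : orbit mu nu -> orbit nu mu.
Proof.
case/orbitP=> P uP h; apply/orbitP; exists (invmx P); first by rewrite unitmx_inv.
by move=> x y; rewrite -{2}(mulKVmx uP x) -{2}(mulKVmx uP y) h mulKmx.
Qed.

Lemma orbit_trans mu nu rho : orbit mu nu -> orbit nu rho -> orbit mu rho.
Proof.
case/orbitP=> P uP h /orbitP[Q uQ k]; apply/orbitP; exists (P *m Q).
  by rewrite unitmx_mul uP.
by move=> x y; rewrite -!mulmxA h k.
Qed.

Lemma orbit_act g mu : g \in unitmx -> orbit mu (act g mu).
Proof. by exists g. Qed.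

Lemma orbit_refl mu : orbit mu mu.
Proof.
by apply/orbitP; exists 1%:M => [|x y]; rewrite ?unitmx1 ?mul1mx.
Qed.

(** * Polynomial functions of the structure constants *)

Definition regular (F : structure -> C) :=
  exists p, forall mu, poly_eval p mu = F mu.

Lemma regular_ext F G : (forall mu, F mu = G mu) -> regular F -> regular G.
Proof. by move=> FG [p hp]; exists p => mu; rewrite hp. Qed.

Lemma regular_cst c : regular (fun=> c).
Proof. by exists c%:MP => mu; rewrite /poly_eval mevalC. Qed.

Lemma regular_coord t : regular (fun mu => mu t).
Proof.
by exists 'X_(enum_rank t) => mu; rewrite /poly_eval mevalXU enum_rankK.
Qed.

Lemma regularD F G : regular F -> regular G -> regular (fun mu => F mu + G mu).
Proof.
by move=> [p hp] [q hq]; exists (p + q) => mu; rewrite -hp -hq /poly_eval mevalD.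
Qed.

Lemma regularM F G : regular F -> regular G -> regular (fun mu => F mu * G mu).
Proof.
by move=> [p hp] [q hq]; exists (p * q) => mu; rewrite -hp -hq /poly_eval mevalM.
Qed.

Lemma regularB F G : regular F -> regular G -> regular (fun mu => F mu - G mu).
Proof.
by move=> [p hp] [q hq]; exists (p - q) => mu; rewrite -hp -hq /poly_eval mevalB.
Qed.

Lemma regular_sum n (F : 'I_n -> structure -> C) :
  (forall i, regular (F i)) -> regular (fun mu => \sum_i F i mu).
Proof.
move=> /fin_all_exists[p hp]; exists (\sum_i p i) => mu.
by rewrite /poly_eval raddf_sum; apply: eq_bigr => i _; exact: hp.
Qed.

(** Substitution of polynomials; it makes the action of a fixed matrix, which is
    linear in the structure constants, preserve polynomial functions. *)
Lemma regular_comp F (Phi : structure -> structure) :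
  regular F -> (forall t, regular (fun mu => Phi mu t)) ->
  regular (fun mu => F (Phi mu)).
Proof.
move=> [p hp] /fin_all_exists[q hq].
exists (p \mPo [tuple q (enum_val i) | i < #|{: 'I_3 * 'I_3 * 'I_3}|]) => mu.
rewrite -hp /poly_eval comp_mpoly_meval; apply: meval_eq => i.
by rewrite tnth_mktuple; exact: hq.
Qed.

Definition regular_mx m n (X : structure -> 'M[C]_(m, n)) :=
  forall i j, regular (fun mu => X mu i j).

Lemma regular_mx_cst m n (X : 'M[C]_(m, n)) : regular_mx (fun=> X).
Proof. by move=> i j; apply: regular_cst. Qed.

Lemma regular_mul X Y : regular_mx X -> regular_mx Y ->
  regular_mx (fun mu => mul mu (X mu) (Y mu)).
Proof.
move=> rX rY k l; apply: (@regular_ext (fun mu => \sum_i \sum_j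
  X mu i 0 * Y mu j 0 * mu (i, j, k))) => [mu|]; first by rewrite mxE.
do 2!(apply: regular_sum => ?); apply: regularM; last exact: regular_coord.
by apply: regularM; [apply: rX|apply: rY].
Qed.

Lemma regular_mulmx m n p (X : structure -> 'M[C]_(m, n))
    (Y : structure -> 'M[C]_(n, p)) :
  regular_mx X -> regular_mx Y -> regular_mx (fun mu => X mu *m Y mu).
Proof.
move=> rX rY i k; apply: (@regular_ext (fun mu => \sum_j X mu i j * Y mu j k)).
  by move=> mu; rewrite mxE.
by apply: regular_sum => j; apply: regularM; [apply: rX|apply: rY].
Qed.

Lemma regular_act g t : regular (fun mu => act g mu t).
Proof.
case: t => [[i j] k].
apply: (@regular_ext (fun mu =>
  (g *m mul mu (invmx g *m e i.+1) (invmx g *m e j.+1)) k 0)).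
  by move=> mu; rewrite ffunE.
by apply: regular_mulmx; [|apply: regular_mul]; apply: regular_mx_cst.
Qed.

Definition degenerates mu nu := zariski_closure (orbit mu) nu.

Lemma degenerates_regular mu nu F : degenerates mu nu -> regular F ->
  (forall rho, orbit mu rho -> F rho = 0) -> F nu = 0.
Proof. by move=> [_ h] [p hp] F0; rewrite -hp h // => rho /F0; rewrite hp. Qed.

(** Closures of invariant sets are invariant: if [p] vanishes on the orbit of
    [mu], so does [p] composed with the action of [g], and this polynomial
    therefore vanishes at [nu]. *)
Lemma degenerates_vanish mu nu p : degenerates mu nu ->
  (forall rho, orbit mu rho -> poly_eval p rho = 0) ->
  forall rho, orbit nu rho -> poly_eval p rho = 0.
Proof.
move=> d p0 _ [g ug ->].
apply: (degenerates_regular d (F := fun nu => poly_eval p (act g nu))).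
  by apply: regular_comp; [exists p|move=> t; apply: regular_act].
by move=> s os; apply: p0; apply: orbit_trans os (orbit_act _ ug).
Qed.

Lemma degenerates_trans mu nu rho :
  degenerates mu nu -> degenerates nu rho -> degenerates mu rho.
Proof.
by move=> d [Nrho h]; split=> // p p0; apply: h; apply: degenerates_vanish d p0.
Qed.

Lemma degenerates_orbit mu nu : Novikov nu -> orbit mu nu -> degenerates mu nu.
Proof. by move=> N o; split=> // p; apply. Qed.

(** * Degenerations along curves *)

Lemma horner0_of_punctured (q : {poly C}) :
  (forall t, t != 0 -> q.[t] = 0) -> q.[0] = 0.
Proof.
move=> h; suff -> : q = 0 by rewrite horner0.
apply: (@roots_geq_poly_eq0 _ _ [seq i.+1%:R | i <- iota 0 (size q)]).
- by apply/allP => _ /mapP[i _ ->]; apply/eqP/h; rewrite pnatr_eq0.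
- rewrite map_inj_uniq ?iota_uniq // => i j /eqP.
  by rewrite eqr_nat eqSS => /eqP.
- by rewrite size_map size_iota.
Qed.

(** A polynomial vanishing on the orbit, restricted to the curve, is a one-variable
    polynomial with infinitely many roots, hence also vanishes at the special
    point of the curve. *)
Lemma degenerates_curve mu nu (c : 'I_3 * 'I_3 * 'I_3 -> {poly C}) :
  Novikov nu -> (forall s, (c s).[0] = nu s) ->
  (forall t, t != 0 -> orbit mu [ffun s => (c s).[t]]) ->
  degenerates mu nu.
Proof.
move=> N c0 ct; split=> // p p0.
pose q := \sum_(m <- msupp p) (p@_m)%:P * \prod_i c (enum_val i) ^+ m i.
have qE t : q.[t] = poly_eval p [ffun s => (c s).[t]].
  rewrite /poly_eval mevalE horner_sum; apply: eq_bigr => m _.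
  rewrite hornerM hornerC horner_prod; congr (_ * _); apply: eq_bigr => i _.
  by rewrite horner_exp ffunE.
have -> : nu = [ffun s => (c s).[0]] by apply/ffunP => s; rewrite ffunE c0.
by rewrite -qE; apply: horner0_of_punctured => t t0; rewrite qE; apply/p0/ct.
Qed.

(** The curve is the action of [diag(t ^ w i)]: it multiplies [mu (i, j, k)] by
    [t ^ (w i + w j - w k)], so that only the weight-preserving constants survive
    at [t = 0]. *)
Lemma degenerates_graded (w : 'I_3 -> nat) mu nu : Novikov nu ->
  (forall i j k, (w i + w j < w k)%N -> mu (i, j, k) = 0) ->
  (forall i j k, nu (i, j, k) = if w i + w j == w k then mu (i, j, k) else 0) ->
  degenerates mu nu.
Proof.
move=> N low nuE.
apply: (@degenerates_curve _ _ (fun s =>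
  mu s *: 'X^(w s.1.1 + w s.1.2 - w s.2))) => // [[[i j] k]|t t0].
  rewrite hornerZ hornerXn /= nuE expr0n subn_eq0.
  case: ltngtP => [/low->||] //; rewrite ?mul0r ?mulr0 ?mulr1 //.
apply/orbitP; exists (diag_mx (\row_i t ^+ w i)).
  rewrite unitmxE det_diag unitfE prodf_seq_neq0; apply/allP => i _.
  by rewrite mxE expf_neq0.
move=> x y; apply: vec_ext => k; rewrite !mul_diag_mx !mxE mulr_sumr.
apply: eq_bigr => i _; rewrite mulr_sumr; apply: eq_bigr => j _.
rewrite !mxE ffunE hornerZ hornerXn /=.
have [/low->|le] := ltnP (w i + w j)%N (w k); first by rewrite mul0r !mulr0.
have -> : t ^+ w i * x i 0 * (t ^+ w j * y j 0) * mu (i, j, k)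
  = t ^+ (w i + w j) * (x i 0 * y j 0 * mu (i, j, k)) by rewrite exprD; ring.
by rewrite -{1}(subnK le) exprD; ring.
Qed.

(** * Change of basis *)

Definition frame u v w : 'M[C]_3 := \matrix_(i, j) [:: u; v; w]`_j i 0.

Lemma frame1 u v w : frame u v w *m e 1 = u.
Proof. by apply: vec_ext => k; rewrite !mxE sum3 !mxE /= mulr1 !mulr0 !addr0. Qed.
Lemma frame2 u v w : frame u v w *m e 2 = v.
Proof. by apply: vec_ext => k; rewrite !mxE sum3 !mxE /= mulr1 !mulr0 addr0 add0r. Qed.
Lemma frame3 u v w : frame u v w *m e 3 = w.
Proof. by apply: vec_ext => k; rewrite !mxE sum3 !mxE /= mulr1 !mulr0 !add0r. Qed.
Definition frameE := (frame1, frame2, frame3).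

Lemma det3 (M : 'M[C]_3) : \det M =
  M i1 i1 * (M i2 i2 * M i3 i3 - M i3 i2 * M i2 i3)
  - M i1 i2 * (M i2 i1 * M i3 i3 - M i3 i1 * M i2 i3)
  + M i1 i3 * (M i2 i1 * M i3 i2 - M i3 i1 * M i2 i2).
Proof.
have d2 (N : 'M[C]_2) : \det N = N 0 0 * N 1 1 - N 0 1 * N 1 0.
  rewrite (expand_det_row _ 0) !big_ord_recl big_ord0 /cofactor !det_mx11 !mxE.
  have -> : lift (0 : 'I_2) (0 : 'I_1) = 1 by apply: val_inj.
  have -> : lift (1 : 'I_2) (0 : 'I_1) = 0 by apply: val_inj.
  by rewrite /= expr0 expr1 mul1r addr0 mulN1r mulrN.
have l1 : [/\ lift i1 (0 : 'I_2) = i2, lift i1 (1 : 'I_2) = i3,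
  lift i2 (0 : 'I_2) = i1 & lift i2 (1 : 'I_2) = i3] by split; apply: val_inj.
have l3 : lift i3 (0 : 'I_2) = i1 /\ lift i3 (1 : 'I_2) = i2 by split; apply: val_inj.
case: l1 l3 => a b c d [f g].
rewrite (expand_det_row _ i1) !big_ord_recl big_ord0 /cofactor !d2.
rewrite (_ : lift ord0 ord0 = i2); last by apply: val_inj.
rewrite (_ : lift ord0 (lift ord0 _) = i3); last by apply: val_inj.
rewrite (_ : ord0 = i1); last by apply: val_inj.
by rewrite !mxE !(a, b, c, d, f, g) /=; ring.
Qed.

(** [d] is kept as a parameter so that the determinant can be given in a form whose
    nonvanishing is visible. *)
Lemma frame_unit (d : C) u v w : d != 0 ->
  u i1 0 * (v i2 0 * w i3 0 - v i3 0 * w i2 0)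
  - v i1 0 * (u i2 0 * w i3 0 - u i3 0 * w i2 0)
  + w i1 0 * (u i2 0 * v i3 0 - u i3 0 * v i2 0) = d ->
  frame u v w \in unitmx.
Proof.
move=> d0 dE; rewrite unitmxE unitfE det3 !mxE /=.
by move: d0; rewrite -dE; congr (_ != 0); ring.
Qed.

(** * Trace forms and twisted products *)

Definition trL mu x := \tr (Lmul mu x).
Definition trR mu x := \tr (Rmul mu x).
Definition trace_gap mu x := trL mu x - trR mu x.

Lemma tr_conj P (M N : 'M[C]_3) :
  P \in unitmx -> M *m P = P *m N -> \tr M = \tr N.
Proof.
move=> uP h; rewrite -[M](mulmxK uP) h -mulmxA mxtrace_mulC.
by rewrite -mulmxA mulVmx // mulmx1.
Qed.

Lemma trL_frame mu nu P x : P \in unitmx ->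
  intertwines P mu nu ->
  trL mu (P *m x) = trL nu x.
Proof.
move=> uP h; apply: tr_conj uP _; apply: mx_ext => y.
by rewrite -!mulmxA -!LmulE.
Qed.

Lemma trR_frame mu nu P x : P \in unitmx ->
  intertwines P mu nu ->
  trR mu (P *m x) = trR nu x.
Proof.
move=> uP h; apply: tr_conj uP _; apply: mx_ext => y.
by rewrite -!mulmxA -!RmulE.
Qed.

Lemma regular_trL X : regular_mx X -> regular (fun mu => trL mu (X mu)).
Proof.
move=> rX; apply: regular_sum => j; apply: (@regular_ext (fun mu =>
  \sum_i X mu i 0 * mu (i, j, j))) => [mu|]; first by rewrite mxE.
by apply: regular_sum => i; apply: regularM; [apply: rX|apply: regular_coord].
Qed.

Lemma regular_trR X : regular_mx X -> regular (fun mu => trR mu (X mu)).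
Proof.
move=> rX; apply: regular_sum => i; apply: (@regular_ext (fun mu =>
  \sum_j X mu j 0 * mu (i, j, i))) => [mu|]; first by rewrite mxE.
by apply: regular_sum => j; apply: regularM; [apply: rX|apply: regular_coord].
Qed.

(** The coefficient of [trace_gap] is free to be chosen for each algebra, because
    [trace_gap] disappears on commutative structures. *)
Definition trace_form s mu x := trR mu x - s * trace_gap mu x.

Lemma trace_form_frame s mu nu P x : P \in unitmx ->
  intertwines P mu nu ->
  trace_form s mu (P *m x) = trace_form s nu x.
Proof.
by move=> uP h; rewrite /trace_form /trace_gap (trL_frame _ uP h) (trR_frame _ uP h).
Qed.

Lemma regular_trace_form s X : regular_mx X -> regular (fun mu => trace_form s mu (X mu)).
Proof.
move=> rX; apply: regularB; first exact: regular_trR.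
apply: regularM; first exact: regular_cst.
by apply: regularB; [apply: regular_trL|apply: regular_trR].
Qed.

(** A family of products that all coincide with [mul mu] when [mu] is commutative. *)
Definition twist a c d mu x y : V :=
  a *: mul mu x y + (1 - a) *: mul mu y x +
  (c * trace_gap mu y) *: x + (d * trace_gap mu x) *: y.

Lemma twist_frame a c d mu nu P x y : P \in unitmx ->
  intertwines P mu nu ->
  twist a c d mu (P *m x) (P *m y) = P *m twist a c d nu x y.
Proof.
move=> uP h; rewrite /twist /trace_gap !(trL_frame _ uP h) !(trR_frame _ uP h) !h.
by rewrite !mulmxDr -!scalemxAr.
Qed.

Lemma regular_twist a c d x y : regular_mx (fun mu => twist a c d mu x y).
Proof.
move=> k l; apply: (@regular_ext (fun mu => a * mul mu x y k l + (1 - a) * mul mu y x k l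
  + c * trace_gap mu y * x k l + d * trace_gap mu x * y k l)) => [mu|].
  by rewrite /twist !mxE.
have rm u v : regular_mx (fun mu => mul mu u v).
  by apply: regular_mul; apply: regular_mx_cst.
have rD u : regular (fun mu => trace_gap mu u).
  by apply: regularB; [apply: regular_trL|apply: regular_trR];
    apply: regular_mx_cst.
apply: regularD; [apply: regularD; [apply: regularD|]|].
- by apply: regularM; [apply: regular_cst|apply: rm].
- by apply: regularM; [apply: regular_cst|apply: rm].
- apply: regularM; last exact: regular_cst.
  by apply: regularM; [apply: regular_cst|apply: rD].
- apply: regularM; last exact: regular_cst.
  by apply: regularM; [apply: regular_cst|apply: rD].
Qed.

(** The quadratic relations satisfied by the products [phi y *: W x]. Unlike the
    existence of [phi] and [W], they are visibly a closed condition. *)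
Definition rank_one a c d mu := forall x y x' y',
  twist a c d mu x y *m (twist a c d mu x' y')^T =
  twist a c d mu x y' *m (twist a c d mu x' y)^T.

Lemma degenerates_trace_form0 s mu nu : degenerates mu nu ->
  (forall x, trace_form s mu x = 0) -> forall x, trace_form s nu x = 0.
Proof.
move=> d h x; apply: (degenerates_regular d (F := fun nu => trace_form s nu x)).
  by apply: regular_trace_form; apply: regular_mx_cst.
by move=> rho /orbitP[P uP hP]; rewrite -(trace_form_frame _ _ uP hP).
Qed.

Lemma degenerates_trace_formM s mu nu : degenerates mu nu ->
  (forall x y, trace_form s mu (mul mu x y) = trace_form s mu x * trace_form s mu y) ->
  forall x y, trace_form s nu (mul nu x y) = trace_form s nu x * trace_form s nu y.
Proof.
move=> d h x y; apply/eqP; rewrite -subr_eq0; apply/eqP.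
have rc (X : V) : regular_mx (fun=> X) by apply: regular_mx_cst.
apply: (degenerates_regular d (F := fun nu =>
  trace_form s nu (mul nu x y) - trace_form s nu x * trace_form s nu y)).
  apply: regularB; first by apply/regular_trace_form/regular_mul.
  by apply: regularM; apply: regular_trace_form.
move=> rho /orbitP[P uP hP].
by rewrite -!(trace_form_frame _ _ uP hP) -hP h subrr.
Qed.

Lemma outer_inj P u v u' v' : P \in unitmx ->
  (P *m u) *m (P *m v)^T = (P *m u') *m (P *m v')^T -> u *m v^T = u' *m v'^T.
Proof.
move=> uP; rewrite !trmx_mul !mulmxA => h.
have uPt : P^T \in unitmx by rewrite unitmx_tr.
apply: (can_inj (mulKmx uP)); apply: (can_inj (mulmxK uPt)).
by rewrite !mulmxA.
Qed.

(** The twist is built naturally from the product, so a change of basis multiplies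
    both sides by [P] on the left and [P^T] on the right; the relations are thus
    invariant under isomorphism and polynomial. *)
Lemma degenerates_rank_one a b c mu nu : degenerates mu nu ->
  rank_one a b c mu -> rank_one a b c nu.
Proof.
move=> d h x y x' y'; apply/matrixP => k l; apply/eqP; rewrite -subr_eq0; apply/eqP.
apply: (degenerates_regular d (F := fun nu =>
  (twist a b c nu x y *m (twist a b c nu x' y')^T) k l -
  (twist a b c nu x y' *m (twist a b c nu x' y)^T) k l)).
  have rT (u v : V) : regular_mx (fun nu => (twist a b c nu u v)^T).
    move=> i j; apply: (@regular_ext (fun nu => twist a b c nu u v j i)).
      by move=> rho; rewrite [RHS]mxE.
    exact: regular_twist.
  by apply: regularB; apply: regular_mulmx => //; apply: regular_twist.
move=> rho /orbitP[P uP hP]; apply/eqP; rewrite subr_eq0; apply/eqP.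
congr (fun_of_matrix _ k l); apply: (outer_inj uP).
by rewrite -!(twist_frame _ _ _ _ _ uP hP); apply: h.
Qed.

Lemma commutative_orbit mu nu :
  orbit mu nu -> commutative (mul nu) -> commutative (mul mu).
Proof.
case/orbitP=> P uP h cnu x y.
by rewrite -(mulKVmx uP x) -(mulKVmx uP y) !h cnu.
Qed.

(** Left and right multiplications coincide. *)
Lemma commutative_trace_gap nu x : commutative (mul nu) -> trace_gap nu x = 0.
Proof.
move=> cnu; rewrite /trace_gap /trL /trR (_ : Lmul nu x = Rmul nu x) ?subrr //.
by apply: mx_ext => y; rewrite -LmulE -RmulE.
Qed.

Lemma commutative_trace_form s nu x :
  commutative (mul nu) -> trace_form s nu x = trR nu x.
Proof. by move=> cnu; rewrite /trace_form commutative_trace_gap // mulr0 subr0. Qed.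

Lemma commutative_twist a c d nu x y :
  commutative (mul nu) -> twist a c d nu x y = mul nu x y.
Proof.
move=> cnu; rewrite /twist !commutative_trace_gap // !mulr0 !scale0r !addr0 (cnu y x).
by rewrite -scalerDl addrC subrK scale1r.
Qed.

(** * Structures given by tables *)

Lemma mul_comm_basis mu :
  (forall i j k, mu (i, j, k) = mu (j, i, k)) -> commutative (mul mu).
Proof.
move=> h x y; apply: vec_ext => k; rewrite !mxE exchange_big /=.
by do 2!apply: eq_bigr => ? _; rewrite h; congr (_ * _); rewrite mulrC.
Qed.

Lemma A_comm n : commutative (mul (A n)).
Proof.
apply: mul_comm_basis; do 2!apply: forall3; move=> k; rewrite !ffunE /=.
all: by do 13?[case: n => [|n] //=].
Qed.

Lemma mul_tableE T x y k : mul (table T) x y k 0 =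
  (x i1 0 * y i1 0 * T 1%N 1%N k 0 + x i1 0 * y i2 0 * T 1%N 2%N k 0 +
   x i1 0 * y i3 0 * T 1%N 3%N k 0) +
  (x i2 0 * y i1 0 * T 2%N 1%N k 0 + x i2 0 * y i2 0 * T 2%N 2%N k 0 +
   x i2 0 * y i3 0 * T 2%N 3%N k 0) +
  (x i3 0 * y i1 0 * T 3%N 1%N k 0 + x i3 0 * y i2 0 * T 3%N 2%N k 0 +
   x i3 0 * y i3 0 * T 3%N 3%N k 0).
Proof. by rewrite mxE !sum3 !ffunE. Qed.

Lemma trL_table T x : trL (table T) x =
  x i1 0 * (T 1%N 1%N i1 0 + T 1%N 2%N i2 0 + T 1%N 3%N i3 0) +
  x i2 0 * (T 2%N 1%N i1 0 + T 2%N 2%N i2 0 + T 2%N 3%N i3 0) +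
  x i3 0 * (T 3%N 1%N i1 0 + T 3%N 2%N i2 0 + T 3%N 3%N i3 0).
Proof.
rewrite /trL /mxtrace sum3 3!mxE !sum3 !ffunE /=; ring.
Qed.

Lemma trR_table T y : trR (table T) y =
  y i1 0 * (T 1%N 1%N i1 0 + T 2%N 1%N i2 0 + T 3%N 1%N i3 0) +
  y i2 0 * (T 1%N 2%N i1 0 + T 2%N 2%N i2 0 + T 3%N 2%N i3 0) +
  y i3 0 * (T 1%N 3%N i1 0 + T 2%N 3%N i2 0 + T 3%N 3%N i3 0).
Proof.
rewrite /trR /mxtrace sum3 3!mxE !sum3 !ffunE /=; ring.
Qed.

(** Both sides are trilinear; the arguments are freed from the basis one at a time. *)
Lemma associative_basis mu :
  (forall i j k : 'I_3, mul mu (e i.+1) (mul mu (e j.+1) (e k.+1)) =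
                        mul mu (mul mu (e i.+1) (e j.+1)) (e k.+1)) ->
  associative (mul mu).
Proof.
move=> h.
have h1 x (j k : 'I_3) :
    mul mu x (mul mu (e j.+1) (e k.+1)) = mul mu (mul mu x (e j.+1)) (e k.+1).
  rewrite RmulE [RHS]RmulE [mul mu x _]RmulE mulmxA.
  congr (_ *m x); apply: mx_ext_basis => i.
  by rewrite -mulmxA -!RmulE.
have h2 x y (k : 'I_3) :
    mul mu x (mul mu y (e k.+1)) = mul mu (mul mu x y) (e k.+1).
  rewrite LmulE [mul mu y _]RmulE [RHS]RmulE [mul mu x y]LmulE !mulmxA.
  congr (_ *m y); apply: mx_ext_basis => j.
  by rewrite -!mulmxA -RmulE -LmulE -LmulE -RmulE.
move=> x y z; rewrite LmulE [mul mu y z]LmulE [RHS]LmulE mulmxA.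
congr (_ *m z); apply: mx_ext_basis => k.
by rewrite -mulmxA -!LmulE.
Qed.

Lemma mul_e_table T a b : (0 < a <= 3)%N -> (0 < b <= 3)%N ->
  mul (table T) (e a) (e b) = T a b.
Proof.
case: a b => [|a] [|b] // la lb; apply: vec_ext => k.
by rewrite (@mul_e_e _ (Ordinal la) (Ordinal lb)) ffunE.
Qed.

Lemma mul_0v mu x : mul mu 0 x = 0. Proof. by rewrite RmulE mulmx0. Qed.
Lemma mul_v0 mu x : mul mu x 0 = 0. Proof. by rewrite LmulE mulmx0. Qed.

Lemma A_assoc n : associative (mul (A n)).
Proof.
apply: associative_basis; do 3!apply: forall3; rewrite /=.
all: do 13?[case: n => [|n]].
all: by rewrite !(mul_0v, mul_v0, mul_e_table).
Qed.

Ltac entry := rewrite !mxE /=; ring.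
Ltac entries := apply: vec_ext; apply: forall3; rewrite mul_tableE; entry.

Lemma Novikov_of_comm_assoc mu :
  commutative (mul mu) -> associative (mul mu) -> Novikov mu.
Proof.
move=> c a; split=> x y z; first by rewrite !a !subrr.
by rewrite -!a (c y).
Qed.

Lemma A_Novikov n : Novikov (A n).
Proof. exact: Novikov_of_comm_assoc (@A_comm n) (@A_assoc n). Qed.

(** * Closed conditions on the noncommutative algebras *)

Lemma C1_trace_gap x : trace_gap (C1 R) x = x i1 0.
Proof. rewrite /trace_gap trR_table trL_table /=; entry. Qed.
Lemma C2_trace_gap x : trace_gap (C2 R) x = x i1 0.
Proof. rewrite /trace_gap trR_table trL_table /=; entry. Qed.
Lemma C3_trace_gap x : trace_gap (C3 R) x = x i1 0.
Proof. rewrite /trace_gap trR_table trL_table /=; entry. Qed.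
Lemma C4_trace_gap x : trace_gap (C4 R) x = x i1 0.
Proof. rewrite /trace_gap trR_table trL_table /=; entry. Qed.
Lemma C5_trace_gap a x : trace_gap (C5 a) x = x i1 0.
Proof. rewrite /trace_gap trR_table trL_table /=; entry. Qed.
Lemma C6_trace_gap b x : trace_gap (C6 b) x = x i1 0.
Proof. rewrite /trace_gap trR_table trL_table /=; entry. Qed.
Lemma C7_trace_gap c x : trace_gap (C7 c) x = x i1 0.
Proof. rewrite /trace_gap trR_table trL_table /=; entry. Qed.

(** The multiple of [x i1 0] to be removed from the right trace is read off from the
    diagonal of the right multiplication by [e 1]. *)
Lemma C1_trace_form x : trace_form (-2) (C1 R) x = x i3 0.
Proof. rewrite /trace_form C1_trace_gap trR_table /=; entry. Qed.
Lemma C2_trace_form x : trace_form (-3) (C2 R) x = 0.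
Proof. rewrite /trace_form C2_trace_gap trR_table /=; entry. Qed.
Lemma C3_trace_form x : trace_form (-2) (C3 R) x = 0.
Proof. rewrite /trace_form C3_trace_gap trR_table /=; entry. Qed.
Lemma C4_trace_form x : trace_form 0 (C4 R) x = 0.
Proof. rewrite /trace_form C4_trace_gap trR_table /=; entry. Qed.
Lemma C5_trace_form a x : trace_form (2 * a) (C5 a) x = 0.
Proof. rewrite /trace_form C5_trace_gap trR_table /=; entry. Qed.
Lemma C6_trace_form b x : trace_form (2 * b) (C6 b) x = x i3 0.
Proof. rewrite /trace_form C6_trace_gap trR_table /=; entry. Qed.
Lemma C7_trace_form c x : trace_form (3 * c) (C7 c) x = 0.
Proof. rewrite /trace_form C7_trace_gap trR_table /=; entry. Qed.

Lemma C1_trace_formM x y :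
  trace_form (-2) (C1 R) (mul (C1 R) x y) =
  trace_form (-2) (C1 R) x * trace_form (-2) (C1 R) y.
Proof. rewrite !C1_trace_form mul_tableE /=; entry. Qed.
Lemma C6_trace_formM b x y :
  trace_form (2 * b) (C6 b) (mul (C6 b) x y) =
  trace_form (2 * b) (C6 b) x * trace_form (2 * b) (C6 b) y.
Proof. rewrite !C6_trace_form mul_tableE /=; entry. Qed.

Lemma rank_one_of (phi : V -> C) (W : V -> V) a c d mu :
  (forall x y, twist a c d mu x y = phi y *: W x) -> rank_one a c d mu.
Proof.
move=> h x y x' y'; rewrite !h !linearZ /= -!scalemxAl !scalerA.
by rewrite mulrC.
Qed.

Lemma twist_coord a c d mu x y k : twist a c d mu x y k 0 =
  a * mul mu x y k 0 + (1 - a) * mul mu y x k 0 +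
  c * trace_gap mu y * x k 0 + d * trace_gap mu x * y k 0.
Proof. by rewrite /twist !mxE. Qed.

Lemma rank_one_of_e1 a c d mu :
  (forall x y, twist a c d mu x y = y i1 0 *: twist a c d mu x (e 1)) ->
  rank_one a c d mu.
Proof. exact: rank_one_of. Qed.

(** The product is [e_1^*(y) W(x) - e_1^*(x) y], up to exchanging the arguments:
    right multiplication by [e 1] is minus the identity on the ideal spanned by
    [e 2] and [e 3]. *)
Lemma C2_rank_one : rank_one 0 0 1 (C2 R).
Proof.
apply: rank_one_of_e1 => x y; apply: vec_ext => k.
rewrite [RHS]mxE !twist_coord !mul_tableE !C2_trace_gap /=.
move: k; apply: forall3; entry.
Qed.

Lemma C3_rank_one : rank_one 1 0 0 (C3 R).
Proof.
apply: rank_one_of_e1 => x y; apply: vec_ext => k.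
rewrite [RHS]mxE !twist_coord !mul_tableE !C3_trace_gap /=.
move: k; apply: forall3; entry.
Qed.

Lemma C4_rank_one : rank_one 0 0 0 (C4 R).
Proof.
apply: rank_one_of_e1 => x y; apply: vec_ext => k.
rewrite [RHS]mxE !twist_coord !mul_tableE !C4_trace_gap /=.
move: k; apply: forall3; entry.
Qed.

(** On the ideal spanned by [e 2] and [e 3], left multiplication by [e 1] is
    [diag (a + 1, 0)] and right multiplication is [diag (a, 0)], so
    [(a + 1) y x - a x y] vanishes when [y] is in the ideal. *)
Lemma C5_rank_one (a : C) : rank_one (- a) 0 0 (C5 a).
Proof.
apply: rank_one_of_e1 => x y; apply: vec_ext => k.
rewrite [RHS]mxE !twist_coord !mul_tableE !C5_trace_gap /=.
move: k; apply: forall3; entry.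
Qed.

(** Right multiplication by [e 1] is [c] times the identity on the ideal spanned
    by [e 2] and [e 3]; subtracting [c f(x) y] from [y x] kills it for [y] in the
    ideal. *)
Lemma C7_rank_one (c : C) : rank_one 0 0 (- c) (C7 c).
Proof.
apply: rank_one_of_e1 => x y; apply: vec_ext => k.
rewrite [RHS]mxE !twist_coord !mul_tableE !C7_trace_gap /=.
move: k; apply: forall3; entry.
Qed.

(** Right multiplication by [y] is [- y_1] on the plane spanned by [e 1] and [e 2]
    and [y_3] on [e 3]; adding [y_1] times the identity leaves a multiple of the
    projection to [e 3]. *)
Lemma C6_rank_one : rank_one 1 1 0 (C6 (-1 : C)).
Proof.
apply: (@rank_one_of (fun y => y i1 0 + y i3 0) (fun x => x i3 0 *: e 3)) => x y.
apply: vec_ext => k; rewrite !twist_coord !mul_tableE !C6_trace_gap /=.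
move: k; apply: forall3; entry.
Qed.

(** * Closed conditions on the commutative algebras *)

Lemma A_trace0 n : (1 <= n <= 12)%N -> (forall x, trR (A n) x = 0) ->
  n \in [:: 1; 5; 9; 10]%N.
Proof.
move=> hn h.
(* In the eight excluded algebras the trace of [e 2 + e 3] is [1], [2] or [3]. *)
have nz k : trR (A n) (e 2 + e 3) = k.+1%:R -> false.
  by rewrite h => /esym/eqP; rewrite pnatr_eq0.
clear h; apply: contraT; do 13?[case: n hn nz => [|n] //= hn nz] => _.
1: apply: (nz 0%N). 2: apply: (nz 1%N). 3: apply: (nz 1%N). 4: apply: (nz 0%N).
5: apply: (nz 1%N). 6: apply: (nz 2%N). 7: apply: (nz 2%N). 8: apply: (nz 2%N).
all: rewrite trR_table; entry.
Qed.

(** A multiplicative trace takes only the values [0] and [1] on idempotents, and the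
    six excluded algebras have an idempotent of trace [2] or [3]. *)
Lemma A_traceM n : (1 <= n <= 12)%N ->
  (forall x y, trR (A n) (mul (A n) x y) = trR (A n) x * trR (A n) y) ->
  n \in [:: 1; 2; 5; 6; 9; 10]%N.
Proof.
move=> hn h.
have idem x k : mul (A n) x x = x -> trR (A n) x = k.+2%:R -> false.
  move=> xx tx; move: (h x x); rewrite xx tx -natrM => /eqP.
  by rewrite eqr_nat -[X in X == _]muln1 eqn_pmul2l.
clear h; apply: contraT; do 13?[case: n hn idem => [|n] //= hn idem] => _.
- apply: (idem (e 2 + e 3) 0%N).
    by entries.
  rewrite trR_table; entry.
- apply: (idem (e 2 + e 3) 0%N).
    by entries.
  rewrite trR_table; entry.
- apply: (idem (e 2) 0%N); first by rewrite mul_e_table.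
  rewrite trR_table; entry.
- apply: (idem (e 2) 0%N); first by rewrite mul_e_table.
  rewrite trR_table; entry.
- apply: (idem (e 3) 1%N); first by rewrite mul_e_table.
  rewrite trR_table; entry.
- apply: (idem (e 3) 1%N); first by rewrite mul_e_table.
  rewrite trR_table; entry.
Qed.

Lemma e_outer_neq0 a b : (0 < a <= 3)%N -> (0 < b <= 3)%N -> e a *m (e b)^T != 0.
Proof.
case: a b => [|a] [|b] // la lb; apply/eqP => /matrixP/(_ (Ordinal la) (Ordinal lb)).
by rewrite !mxE big_ord1 !mxE /= !eqxx mulr1 => /eqP; rewrite oner_eq0.
Qed.

(** In these algebras there are [u v] and [x y] nonzero with [u y = 0]. *)
Lemma A_rank_one n a c d : rank_one a c d (A n) ->
  n \notin [:: 6; 9; 10]%N.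
Proof.
move=> h.
have z u v x y : mul (A n) u y = 0 -> mul (A n) u v *m (mul (A n) x y)^T = 0.
  move=> h0; move: (h u v x y); rewrite !(commutative_twist _ _ _ _ _ (@A_comm n)).
  by rewrite h0 mul0mx.
clear h; apply/negP; rewrite !inE => /or3P[] /eqP nE; subst n.
- have := z (e 2) (e 2) (e 3) (e 3); rewrite !mul_e_table //= => /(_ erefl)/eqP.
  by rewrite (negPf (e_outer_neq0 _ _)).
- have := z (e 2) (e 3) (e 3) (e 2); rewrite !mul_e_table //= => /(_ erefl)/eqP.
  by rewrite (negPf (e_outer_neq0 _ _)).
- have := z (e 2) (e 3) (e 3) (e 2); rewrite !mul_e_table //= => /(_ erefl)/eqP.
  by rewrite (negPf (e_outer_neq0 _ _)).
Qed.

(** * Explicit degenerations *)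

Lemma orbit_frame mu u v w : frame u v w \in unitmx ->
  orbit mu (act (invmx (frame u v w)) mu).
Proof. by move=> uF; apply: orbit_act; rewrite unitmx_inv. Qed.

Lemma orbit_degenerates mu mu1 nu :
  orbit mu mu1 -> degenerates mu1 nu -> degenerates mu nu.
Proof.
move=> o [N h]; split=> // p p0; apply: h => rho orho; apply: p0.
exact: orbit_trans o orho.
Qed.

Lemma mul_frame mu u v w x y z : frame u v w \in unitmx ->
  mul mu (frame u v w *m x) (frame u v w *m y) = frame u v w *m z ->
  mul (act (invmx (frame u v w)) mu) x y = z.
Proof. by move=> uF h; rewrite mul_act invmxK h mulKmx. Qed.

(** All basis vectors have weight [1], so no structure constant preserves weights. *)
Lemma degenerates_A1 mu : degenerates mu (A 1).
Proof.
apply: (@degenerates_graded (fun=> 1%N)) => // [|i j k]; first exact: A_Novikov.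
by rewrite ffunE /= mxE.
Qed.

Lemma coord_of_mul mu (i j k : 'I_3) x :
  mul mu (e i.+1) (e j.+1) = x -> mu (i, j, k) = x k 0.
Proof. by move=> <-; rewrite mul_e_e. Qed.

(** With [u = v v], [v], [w] of weights [2], [1], [2], only [v v] has components of
    the same weight, and by assumption it has no component along [w]. *)
Lemma degenerates_A5 mu u v w : frame u v w \in unitmx -> mul mu v v = u ->
  degenerates mu (A 5).
Proof.
move=> uF vv; apply: orbit_degenerates (orbit_frame _ uF) _; set nu := act _ _.
have h22 k : nu (i2, i2, k) = e 1 k 0.
  by apply: coord_of_mul; apply: mul_frame; rewrite // !frameE.
apply: (@degenerates_graded (fun i => nth 0%N [:: 2; 1; 2]%N i)) => //.
- exact: A_Novikov.
- by do 3!apply: forall3.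
- by do 3!apply: forall3; rewrite ffunE /= ?h22 ?mxE.
Qed.

(** Weight [0] for the idempotent and [1] for the other two vectors: the products
    of the latter have weight [2] and disappear. *)
Lemma degenerates_A2 mu : mul mu (e 3) (e 3) = e 3 ->
  (forall a, (1 <= a <= 2)%N -> mul mu (e a) (e 3) = 0 /\ mul mu (e 3) (e a) = 0) ->
  degenerates mu (A 2).
Proof.
move=> h33 h.
have [h13 h31] := h 1%N isT; have [h23 h32] := h 2%N isT.
have c33 k := @coord_of_mul mu i3 i3 k _ h33.
have c13 k := @coord_of_mul mu i1 i3 k _ h13.
have c31 k := @coord_of_mul mu i3 i1 k _ h31.
have c23 k := @coord_of_mul mu i2 i3 k _ h23.
have c32 k := @coord_of_mul mu i3 i2 k _ h32.
apply: (@degenerates_graded (fun i => nth 0%N [:: 1; 1; 0]%N i)) => //.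
- exact: A_Novikov.
- by do 3!apply: forall3; rewrite //= ?c33 ?c13 ?c31 ?c23 ?c32 ?mxE.
- by do 3!apply: forall3; rewrite ffunE /= ?c33 ?c13 ?c31 ?c23 ?c32 ?mxE.
Qed.

(** The basis [v v], [v], [e 3] has weights [2], [1], [0]. Besides [v v], only
    products with [e 3] may fail to have larger weight than their components, and
    all of these are zero except the idempotent itself. *)
Lemma degenerates_A6 mu u v : frame u v (e 3) \in unitmx -> mul mu v v = u ->
  mul mu (e 3) (e 3) = e 3 ->
  mul mu u (e 3) = 0 -> mul mu (e 3) u = 0 -> mul mu v (e 3) = 0 -> mul mu (e 3) v = 0 ->
  degenerates mu (A 6).
Proof.
move=> uF h22 h33 h13 h31 h23 h32.
apply: orbit_degenerates (orbit_frame _ uF) _; set nu := act _ _.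
have c22 k : nu (i2, i2, k) = e 1 k 0.
  by apply: coord_of_mul; apply: mul_frame; rewrite // !frameE.
have c33 k : nu (i3, i3, k) = e 3 k 0.
  by apply: coord_of_mul; apply: mul_frame; rewrite // !frameE.
have c13 k : nu (i1, i3, k) = (0 : V) k 0.
  by apply: coord_of_mul; apply: mul_frame; rewrite // !frameE mulmx0.
have c31 k : nu (i3, i1, k) = (0 : V) k 0.
  by apply: coord_of_mul; apply: mul_frame; rewrite // !frameE mulmx0.
have c23 k : nu (i2, i3, k) = (0 : V) k 0.
  by apply: coord_of_mul; apply: mul_frame; rewrite // !frameE mulmx0.
have c32 k : nu (i3, i2, k) = (0 : V) k 0.
  by apply: coord_of_mul; apply: mul_frame; rewrite // !frameE mulmx0.
apply: (@degenerates_graded (fun i => nth 0%N [:: 2; 1; 0]%N i)) => //.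
- exact: A_Novikov.
- by do 3!apply: forall3; rewrite //= ?c33 ?c13 ?c31 ?c23 ?c32 ?mxE.
- by do 3!apply: forall3; rewrite ffunE /= ?c22 ?c33 ?c13 ?c31 ?c23 ?c32 ?mxE.
Qed.

(** [A 6] is the product of the nilpotent algebra generated by [e 2] and the field
    generated by [e 3]. The element [e 2 + e 3] generates it: its powers
    [e 2 + e 3], [e 1 + e 3], [e 3] form a basis, and giving them weights
    [1], [2], [3] makes the fourth power disappear. *)
Lemma A6_degenerates_A10 : degenerates (A 6) (A 10).
Proof.
have uF : frame (e 3) (e 1 + e 3) (e 2 + e 3) \in unitmx.
  by apply: (@frame_unit 1); rewrite ?oner_eq0 //; entry.
apply: orbit_degenerates (orbit_frame _ uF) _; set nu := act _ _.
have c33 k : nu (i3, i3, k) = e 2 k 0.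
  apply: coord_of_mul; apply: mul_frame; rewrite // !frameE.
  by entries.
have c23 k : nu (i2, i3, k) = e 1 k 0.
  apply: coord_of_mul; apply: mul_frame; rewrite // !frameE.
  by entries.
have c32 k : nu (i3, i2, k) = e 1 k 0.
  apply: coord_of_mul; apply: mul_frame; rewrite // !frameE.
  by entries.
apply: (@degenerates_graded (fun i => nth 0%N [:: 3; 2; 1]%N i)) => //.
- exact: A_Novikov.
- by do 3!apply: forall3; rewrite //= ?c33 ?mxE.
- by do 3!apply: forall3; rewrite ffunE /= ?c33 ?c23 ?c32 ?mxE.
Qed.

(** With weights [2], [1], [1] the product [e_3 e_3 = e_2] should have weight [2]
    but lands in weight [1], so it disappears. *)
Lemma A10_degenerates_A9 : degenerates (A 10) (A 9).
Proof.
apply: (@degenerates_graded (fun i => nth 0%N [:: 2; 1; 1]%N i)) => //.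
- exact: A_Novikov.
- by do 3!apply: forall3.
- by do 3!apply: forall3; rewrite !ffunE /= ?mxE.
Qed.

Lemma A6_degenerates_A5 : degenerates (A 6) (A 5).
Proof.
apply: (@degenerates_A5 _ (e 1) (e 2) (e 3)); last by rewrite mul_e_table.
by apply: (@frame_unit 1); rewrite ?oner_eq0 //; entry.
Qed.

(** * Boundaries *)

(** Commutativity is invariant under isomorphism, which takes [A n] out of the orbit. *)
Lemma lies_in_boundaryE n mu : ~ commutative (mul mu) ->
  lies_in_boundary (A n) mu <-> degenerates mu (A n).
Proof.
move=> nc; split=> [[nu o [d _]]|d].
  apply: degenerates_trans d (degenerates_orbit (@A_Novikov n) (orbit_sym o)).
exists (A n); first exact: orbit_refl.
by split=> // /commutative_orbit/(_ (@A_comm n)).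
Qed.

Lemma degenerates_A_trace0 s mu n : (1 <= n <= 12)%N ->
  (forall x, trace_form s mu x = 0) ->
  degenerates mu (A n) -> n \in [:: 1; 5; 9; 10]%N.
Proof.
move=> hn h d; apply: A_trace0 => // x.
by rewrite -(commutative_trace_form s x (@A_comm n)) (degenerates_trace_form0 d h).
Qed.

Lemma degenerates_A_traceM s mu n : (1 <= n <= 12)%N ->
  (forall x y, trace_form s mu (mul mu x y) = trace_form s mu x * trace_form s mu y) ->
  degenerates mu (A n) -> n \in [:: 1; 2; 5; 6; 9; 10]%N.
Proof.
move=> hn h d; apply: A_traceM => // x y.
by rewrite -!(commutative_trace_form s _ (@A_comm n)) (degenerates_trace_formM d h).
Qed.

Lemma degenerates_A_rank_one a c b mu n : rank_one a c b mu ->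
  degenerates mu (A n) -> n \notin [:: 6; 9; 10]%N.
Proof. by move=> h d; apply: A_rank_one (degenerates_rank_one d h). Qed.

(** The two closed conditions complement each other: the trace condition leaves
    [A 1], [A 5], [A 9], [A 10], and the quadratic relations discard the last two. *)
Lemma boundary_A1_A5 s a c d mu n : (1 <= n <= 12)%N -> ~ commutative (mul mu) ->
  (forall x, trace_form s mu x = 0) -> rank_one a c d mu -> degenerates mu (A 5) ->
  lies_in_boundary (A n) mu <-> n \in [:: 1; 5]%N.
Proof.
move=> hn nc h1 h2 d5; apply: (iff_trans (lies_in_boundaryE n nc)); split.
  move=> dg; have := degenerates_A_trace0 hn h1 dg.
  have := degenerates_A_rank_one h2 dg.
  by rewrite !inE; do !case: eqP => //.
by rewrite !inE => /orP[]/eqP->; [apply: degenerates_A1|].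
Qed.

Lemma boundary_up_to_A6 s mu n : (1 <= n <= 12)%N -> ~ commutative (mul mu) ->
  (forall x y, trace_form s mu (mul mu x y) = trace_form s mu x * trace_form s mu y) ->
  degenerates mu (A 2) -> degenerates mu (A 6) ->
  lies_in_boundary (A n) mu <-> n \in [:: 1; 2; 5; 6; 9; 10]%N.
Proof.
move=> hn nc h1 d2 d6; apply: (iff_trans (lies_in_boundaryE n nc)); split.
  exact: degenerates_A_traceM.
have d10 := degenerates_trans d6 A6_degenerates_A10.
have d9 := degenerates_trans d10 A10_degenerates_A9.
have d5 := degenerates_trans d6 A6_degenerates_A5.
have d1 := degenerates_A1 mu.
by rewrite !inE; do ![case/orP] => /eqP->.
Qed.

(** The trace gap of a commutative structure is zero, whereas here it is [1] at [e 1]. *)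
Lemma noncommutative_trace_gap mu :
  (forall x, trace_gap mu x = x i1 0) -> ~ commutative (mul mu).
Proof.
move=> h c; have := h (e 1); rewrite commutative_trace_gap // mxE /= => /eqP.
by rewrite eq_sym oner_eq0.
Qed.

Lemma C1_A6 : degenerates (C1 R) (A 6).
Proof.
apply: (@degenerates_A6 _ (- e 1 + e 2) (e 1)); rewrite ?mul_e_table //.
- apply: (@frame_unit (-1)); first by rewrite oppr_eq0 oner_eq0.
  entry.
- by entries.
- by entries.
Qed.

(** The determinant of [v v], [v], [e 3] for [v = e 1 + e 2] is [- (b + 1)]. *)
Lemma C6_A6 (b : C) : b <> -1 -> degenerates (C6 b) (A 6).
Proof.
move=> /eqP b1.
apply: (@degenerates_A6 _ (b *: e 1 + (2 * b + 1) *: e 2) (e 1 + e 2));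
  rewrite ?mul_e_table //.
- apply: (@frame_unit (- (b + 1))); first by rewrite oppr_eq0 addr_eq0.
  entry.
all: by entries.
Qed.

Lemma C1_A2 : degenerates (C1 R) (A 2).
Proof.
apply: degenerates_A2; first by rewrite mul_e_table.
by move=> [|[|[|a]]] //; rewrite !mul_e_table.
Qed.

Lemma C6_A2 (b : C) : degenerates (C6 b) (A 2).
Proof.
apply: degenerates_A2; first by rewrite mul_e_table.
by move=> [|[|[|a]]] //; rewrite !mul_e_table.
Qed.

Lemma C2_A5 : degenerates (C2 R) (A 5).
Proof.
apply: (@degenerates_A5 _ (- e 1 + e 2) (e 1) (e 3)); last by rewrite mul_e_table.
apply: (@frame_unit (-1)); first by rewrite oppr_eq0 oner_eq0.
entry.
Qed.

Lemma C3_A5 : degenerates (C3 R) (A 5).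
Proof.
apply: (@degenerates_A5 _ (- e 1 + e 2) (e 1) (e 3)); last by rewrite mul_e_table.
apply: (@frame_unit (-1)); first by rewrite oppr_eq0 oner_eq0.
entry.
Qed.

Lemma C4_A5 : degenerates (C4 R) (A 5).
Proof.
apply: (@degenerates_A5 _ (e 3) (e 1) (e 2)); last by rewrite mul_e_table.
apply: (@frame_unit 1); first by rewrite oner_eq0.
entry.
Qed.

Lemma C5_A5 (a : C) : degenerates (C5 a) (A 5).
Proof.
(* For a = -1 the vector e 1 + e 2 is proportional to its square. *)
have [->|a1] := eqVneq a (-1).
  apply: (@degenerates_A5 _ (- e 1) (e 1 + e 3) (e 2)).
    apply: (@frame_unit 1); first by rewrite oner_eq0.
    entry.
  by entries.
apply: (@degenerates_A5 _ (a *: e 1 + (2 * a + 1) *: e 2) (e 1 + e 2) (e 3)).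
  apply: (@frame_unit (- (a + 1))); first by rewrite oppr_eq0 addr_eq0.
  entry.
by entries.
Qed.

Lemma C6_A5 : degenerates (C6 (-1 : C)) (A 5).
Proof.
apply: (@degenerates_A5 _ (- e 1 + e 3) (e 1 + e 3) (e 2)).
  apply: (@frame_unit 2); first by rewrite pnatr_eq0.
  entry.
by entries.
Qed.

Lemma C7_A5 (c : C) : c <> 0 -> degenerates (C7 c) (A 5).
Proof.
move=> /eqP c0.
apply: (@degenerates_A5 _ (c *: e 1 + (2 * c) *: e 3) (e 1 + e 3) (e 2)).
  apply: (@frame_unit c); first by [].
  entry.
by entries.
Qed.

(** For this parameter [C6] satisfies the conditions of both kinds, and their
    conjunction leaves exactly [A 1], [A 2], [A 5]. *)
Lemma C6_boundary n : (1 <= n <= 12)%N ->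
  lies_in_boundary (A n) (C6 (-1 : C)) <-> n \in [:: 1; 2; 5]%N.
Proof.
move=> hn; have nc := noncommutative_trace_gap (C6_trace_gap (-1 : C)).
apply: (iff_trans (lies_in_boundaryE n nc)); split.
  move=> dg; have := degenerates_A_traceM hn (C6_trace_formM (-1)) dg.
  have := degenerates_A_rank_one C6_rank_one dg.
  by rewrite !inE; do !case: eqP => //.
rewrite !inE => /or3P[]/eqP->.
- exact: degenerates_A1.
- exact: C6_A2.
- exact: C6_A5.
Qed.

End NovikovDegenerations.

Theorem proposition4p8 (R : realType) (j : nat) (hj : (1 <= j <= 12)%N) :
  (lies_in_boundary (A R j) (C1 R) <-> j \in [:: 1; 2; 5; 6; 9; 10]%N) /\
  (lies_in_boundary (A R j) (C2 R) <-> j \in [:: 1; 5]%N) /\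
  (lies_in_boundary (A R j) (C3 R) <-> j \in [:: 1; 5]%N) /\
  (lies_in_boundary (A R j) (C4 R) <-> j \in [:: 1; 5]%N) /\
  (forall alpha : R[i],
     lies_in_boundary (A R j) (C5 alpha) <-> j \in [:: 1; 5]%N) /\
  (forall beta : R[i], beta <> -1 ->
     (lies_in_boundary (A R j) (C6 beta) <->
        j \in [:: 1; 2; 5; 6; 9; 10]%N)) /\
  (lies_in_boundary (A R j) (C6 (-1 : R[i])) <-> j \in [:: 1; 2; 5]%N) /\
  (forall gamma : R[i], gamma <> 0 ->
     (lies_in_boundary (A R j) (C7 gamma) <-> j \in [:: 1; 5]%N)).
Proof.
split; [|split; [|split; [|split; [|split; [|split; [|split]]]]]].
- apply: boundary_up_to_A6 hj (noncommutative_trace_gap (@C1_trace_gap R)) _ _ _.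
  + exact: C1_trace_formM.
  + exact: C1_A2.
  + exact: C1_A6.
- apply: boundary_A1_A5 hj (noncommutative_trace_gap (@C2_trace_gap R)) _ _ _.
  + exact: C2_trace_form.
  + exact: C2_rank_one.
  + exact: C2_A5.
- apply: boundary_A1_A5 hj (noncommutative_trace_gap (@C3_trace_gap R)) _ _ _.
  + exact: C3_trace_form.
  + exact: C3_rank_one.
  + exact: C3_A5.
- apply: boundary_A1_A5 hj (noncommutative_trace_gap (@C4_trace_gap R)) _ _ _.
  + exact: C4_trace_form.
  + exact: C4_rank_one.
  + exact: C4_A5.
- move=> alpha.
  apply: boundary_A1_A5 hj (noncommutative_trace_gap (C5_trace_gap alpha)) _ _ _.
  + exact: C5_trace_form.
  + exact: C5_rank_one.
  + exact: C5_A5.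
- move=> beta b1.
  apply: boundary_up_to_A6 hj (noncommutative_trace_gap (C6_trace_gap beta)) _ _ _.
  + exact: C6_trace_formM.
  + exact: C6_A2.
  + exact: C6_A6.
- exact: C6_boundary.
- move=> gamma c0.
  apply: boundary_A1_A5 hj (noncommutative_trace_gap (C7_trace_gap gamma)) _ _ _.
  + exact: C7_trace_form.
  + exact: C7_rank_one.
  + exact: C7_A5.
Qed.
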